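(* Let $X,Y$ be normed spaces, $F_1:X\rightrightarrows Y$ and $F_2:Y\rightrightarrows X$ set-valued mappings, $L\subset S_X$ and $M\subset S_Y$ nonempty, and define $\mathcal{F}:X\times Y\rightrightarrows X\times Y$ by $\mathcal{F}(x,y):=F_2(y)\times F_1(x)$. Let $U\subset X$ and $V\subset Y$ be open sets, and let $\tau_1,\tau_2>0$. Assume that: (i) $F_1$ is Milyutin directionally regular on $U\times V$ w.r.t. $L$ and $M$, as well as w.r.t. $-L$ and $-M$, with constant $\tau_1$; (ii) $F_2$ is Milyutin directionally regular on $V\times U$ w.r.t. $M$ and $L$, as well as w.r.t. $-M$ and $-L$, with constant $\tau_2$; (iii) $\tau:=\max\{\tau_1,\tau_2\}<1$; (iv) there exists $(\overline{u},\overline{v})\in U\times V$ such that one of the following conditions holds: $$(\gamma)\quad \max\{T_L(\overline{u},F_1^{-1}(\overline{v})),T_M(\overline{v},F_2^{-1}(\overline{u}))\}<(1-\tau)\min\{\mathbf{d}(\overline{u},X\setminus U),\mathbf{d}(\overline{v},Y\setminus V)\},$$ $$(\delta)\quad \max\{T_{-L}(\overline{u},F_1^{-1}(\overline{v})),T_{-M}(\overline{v},F_2^{-1}(\overline{u}))\}<(1-\tau)\min\{\mathbf{d}(\overline{u},X\setminus U),\mathbf{d}(\overline{v},Y\setminus V)\}.$$ Equip $X\times Y$ with the norm $\|(x,y)\|_1:=\max\{\|x\|,\|y\|\}$. Then the following assertions hold. (a) For every $\varepsilon>0$, $\operatorname{Fix}(\mathcal{F})(\varepsilon)\cap(U\times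 V)\neq\emptyset$. Moreover, if $(\gamma)$ holds, then $$\mathbf{d}\bigl((\overline{u},\overline{v}),\operatorname{Fix}(\mathcal{F})(\varepsilon)\cap(U\times V)\bigr)\le\frac{T_{L\times M}\bigl((\overline{u},\overline{v}),\mathcal{F}^{-1}(\overline{u},\overline{v})\bigr)}{1-\tau},$$ whereas if $(\delta)$ holds, then $$\mathbf{d}\bigl((\overline{u},\overline{v}),\operatorname{Fix}(\mathcal{F})(\varepsilon)\cap(U\times V)\bigr)\le\frac{T_{-(L\times M)}\bigl((\overline{u},\overline{v}),\mathcal{F}^{-1}(\overline{u},\overline{v})\bigr)}{1-\tau}.$$ (b) If $X$ and $Y$ are complete and both $F_1$ and $F_2$ have closed graphs, then $\operatorname{Fix}(\mathcal{F})\cap(U\times V)\neq\emptyset$. Furthermore, if $(\gamma)$ holds, then $$\mathbf{d}\bigl((\overline{u},\overline{v}),\operatorname{Fix}(\mathcal{F})\cap(U\times V)\bigr)\le\frac{T_{L\times M}\bigl((\overline{u},\overline{v}),\mathcal{F}^{-1}(\overline{u},\overline{v})\bigr)}{1-\tau},$$ whereas if $(\delta)$ holds, then $$\mathbf{d}\bigl((\overline{u},\overline{v}),\operatorname{Fix}(\mathcal{F})\cap(U\times V)\bigr)\le\frac{T_{-(L\times M)}\bigl((\overline{u},\overline{v}),\mathcal{F}^{-1}(\overline{u},\overline{v})\bigr)}{1-\tau}.$$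
   Context: $S_X,S_Y$ are unit spheres; $\mathbf{d}(z,A)=\inf_{a\in A}\|z-a\|$ with $\mathbf{d}(z,\emptyset)=+\infty$ (in $X\times Y$ the norm is $\|\cdot\|_1$); $F_1^{-1}(y)=\{x:y\in F_1(x)\}$, and similarly for other mappings. For $\emptyset\ne L\subset S_X$, $A\subset X$, the directional minimal time function is $T_L(x,A):=\inf\{t\ge0:(x+tL)\cap A\ne\emptyset\}$ with $\inf\emptyset=+\infty$; similarly on $Y$. On $X\times Y$, the minimal time function of a product set $A\times B$ is given by $T_{L\times M}((x,y),A\times B)=\max\{T_L(x,A),T_M(y,B)\}$, and $T_{-(L\times M)}((x,y),A\times B)=\max\{T_{-L}(x,A),T_{-M}(y,B)\}$. Note $\mathcal{F}^{-1}(u,v)=F_1^{-1}(v)\times F_2^{-1}(u)$. $\operatorname{Fix}(\mathcal{F})(\varepsilon):=\{z:\mathbf{d}(z,\mathcal{F}(z))\le\varepsilon\}$ and $\operatorname{Fix}(\mathcal{F}):=\{z:z\in\mathcal{F}(z)\}$. $F_1$ is Milyutin directionally regular on $U\times V$ w.r.t. $L$ and $M$ with constant $\tau_1$ if for every $(x,y)\in U\times V$: $\tau_1T_M(y,F_1(x))<\mathbf{d}(x,X\setminus U)\Rightarrow T_L(x,F_1^{-1}(y))\le\tau_1T_M(y,F_1(x))$. Likewise, $F_2$ is Milyutin directionally regular on $V\times U$ w.r.t. $M$ and $L$ with constant $\tau_2$ if for every $(y,x)\in V\times U$: $\tau_2T_L(x,F_2(y))<\mathbf{d}(y,Y\setminus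 V)\Rightarrow T_M(y,F_2^{-1}(x))\le\tau_2T_L(x,F_2(y))$. The versions w.r.t. $-L,-M$ are obtained by replacing $L,M$ by $-L,-M$. *)

(* Defs.v *)
From HB Require Import structures.
From mathcomp Require Import all_boot all_order all_algebra.
From mathcomp Require Import all_classical all_reals all_analysis.

Set Implicit Arguments.
Unset Strict Implicit.
Unset Printing Implicit Defensive.

Import Order.TTheory GRing.Theory Num.Theory.
Import numFieldNormedType.Exports.

Local Open Scope classical_set_scope.
Local Open Scope ring_scope.
Local Open Scope ereal_scope.

(* A set-valued mapping from A to B is a function A -> set B. *)

Definition inv_map (A B : Type) (F : A -> set B) (b : B) : set A :=
  [set a | F a b].

Definition graph (A B : Type) (F : A -> set B) : set (A * B) :=
  [set p | F p.1 p.2].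

Definition unit_sphere (R : realType) (Z : normedModType R) : set Z :=
  [set z | `|z|%R = 1%R].

(* The infimum of the empty set is +oo, hence dist z set0 = +oo. On X * Y the
   library norm is the maximum norm, see prod_max_norm below. *)
Definition dist (R : realType) (Z : normedModType R) (z : Z) (A : set Z)
    : \bar R :=
  ereal_inf [set `|z - a|%:E | a in A].

Definition min_time (R : realType) (Z : normedModType R) (L : set Z) (z : Z)
    (A : set Z) : \bar R :=
  ereal_inf [set t%:E | t in
    [set t : R | (0 <= t)%R /\ [set (z + t *: l)%R | l in L] `&` A !=set0]].

Definition opp_set (R : realType) (Z : normedModType R) (L : set Z) : set Z :=
  [set (- l)%R | l in L].

(* The minimal time function T_(L x M) on a product space, meant for product
   target sets C = A `*` B: the time to hit A and the time to hit B are taken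
   separately, and the maximum is returned (see min_time_prodE; the factors are
   recovered as the projections of C). This differs from
   min_time (L `*` M) z C, which requires one common t for both components. *)
Definition min_time_prod (R : realType) (X Y : normedModType R)
    (L : set X) (M : set Y) (z : X * Y) (C : set (X * Y)) : \bar R :=
  maxe (min_time L z.1 [set p.1 | p in C]) (min_time M z.2 [set p.2 | p in C]).

Definition milyutin_regular (R : realType) (X Y : normedModType R)
    (F : X -> set Y) (U : set X) (V : set Y) (L : set X) (M : set Y) (tau : R)
    : Prop :=
  forall (x : X) (y : Y), U x -> V y ->
    tau%:E * min_time M y (F x) < dist x (~` U) ->
    min_time L x (inv_map F y) <= tau%:E * min_time M y (F x).

Definition prod_map (X Y : Type) (F1 : X -> set Y) (F2 : Y -> set X)
    (z : X * Y) : set (X * Y) :=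
  F2 z.2 `*` F1 z.1.

Definition Fix (Z : Type) (F : Z -> set Z) : set Z := [set z | F z z].

Definition approx_Fix (R : realType) (Z : normedModType R) (F : Z -> set Z)
    (eps : R) : set Z :=
  [set z | dist z (F z) <= eps%:E].

(* The axiom of the library structure completeType, as a proposition about a
   space that is not assumed complete. *)
Definition is_complete (T : puniformType) : Prop :=
  forall G : set_system T, ProperFilter G -> cauchy G -> cvg G.

Lemma prod_max_norm (R : realType) (X Y : normedModType R) (x : X) (y : Y) :
  `|(x, y)|%R = Num.max `|x|%R `|y|%R.
Proof. by []. Qed.

Lemma inv_prod_map (X Y : Type) (F1 : X -> set Y) (F2 : Y -> set X)
    (u : X) (v : Y) :
  inv_map (prod_map F1 F2) (u, v) = inv_map F1 v `*` inv_map F2 u.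
Proof. by apply/seteqP; split => -[x y] [] /=. Qed.

Lemma min_time_set0 (R : realType) (Z : normedModType R) (L : set Z) (z : Z) :
  min_time L z set0 = +oo.
Proof.
rewrite /min_time (_ : [set t : R | _] = set0) ?image_set0 ?ereal_inf0//.
by rewrite -subset0 => t [_]; rewrite setI0 => -[].
Qed.

Lemma min_time_prodE (R : realType) (X Y : normedModType R)
    (L : set X) (M : set Y) (x : X) (y : Y) (A : set X) (B : set Y) :
  min_time_prod L M (x, y) (A `*` B) = maxe (min_time L x A) (min_time M y B).
Proof.
rewrite /min_time_prod /=.
have [->|/set0P[a Aa]] := eqVneq A set0.
  by rewrite set0X !image_set0 !min_time_set0 !maxye.
have [->|/set0P[b Bb]] := eqVneq B set0.
  by rewrite setX0 !image_set0 !min_time_set0 !maxey.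
have -> : [set p.1 | p in A `*` B] = A.
  by apply/seteqP; split => [_ [p [? _] <-]|a' ?]//; exists (a', b).
have -> // : [set p.2 | p in A `*` B] = B.
by apply/seteqP; split => [_ [p [_ ?] <-]|b' ?]//; exists (a, b').
Qed.

(* Main.v *)
(* A Lyusternik-Graves type iteration: starting from z_0 = (ubar, vbar), choose
   z_n such that z_n lies in calF (z_(n+1)). Under (gamma) the first step uses
   the directions L, M and has length less than c (1 - k), for some
   c > T / (1 - tau) and tau < k < 1; each application of Milyutin regularity
   flips the sign of the directions and shrinks the step length by the factor
   k. The orbit is Cauchy and stays in the closed c-ball around z_0, which lies
   in U x V; its far terms are approximate fixed points, and its limit is a
   fixed point when the graphs are closed. (delta) is (gamma) for -L, -M. *)
Require Import Defs.
From HB Require Import structures.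
From mathcomp Require Import all_boot all_order all_algebra.
From mathcomp Require Import all_classical all_reals all_analysis.
From mathcomp Require Import ring.

Set Implicit Arguments.
Unset Strict Implicit.

Import Order.TTheory GRing.Theory Num.Theory.
Import numFieldNormedType.Exports.

Local Open Scope classical_set_scope.

Local Open Scope classical_set_scope.
Local Open Scope ring_scope.

(** * Steps along directions and minimal times *)

(** Witness form of a strict bound on [min_time]: the infimum need not be attained, so only [t < b]
    yields actual points. *)
Definition ray_step (R : realType) (Z : normedModType R) (L : set Z) (b : R)
    (x y : Z) : Prop :=
  exists t l, [/\ 0 <= t, t < b, L l & y = x + t *: l].

Lemma opp_setK (R : realType) (Z : normedModType R) (L : set Z) :
  opp_set (opp_set L) = L.
Proof.
apply/seteqP; split => [_ [_ [l Ll <-] <-]|l Ll]; first by rewrite opprK.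
by exists (- l); [exists l | rewrite opprK].
Qed.

Lemma opp_set_sphere (R : realType) (Z : normedModType R) (L : set Z) :
  L `<=` unit_sphere (Z := Z) -> opp_set L `<=` unit_sphere (Z := Z).
Proof. by move=> Ls _ [l /Ls ? <-]; rewrite /unit_sphere /= normrN. Qed.

(** Source of the sign flips: the step that led to a point, traversed backwards, bounds the minimal
    time at that point along the opposite directions. *)
Lemma ray_step_opp (R : realType) (Z : normedModType R) (L : set Z) (b : R)
  (x y : Z) : ray_step L b x y -> ray_step (opp_set L) b y x.
Proof.
move=> [t [l [t0 tb Ll ->]]]; exists t, (- l); split => //; first by exists l.
by rewrite scalerN addrK.
Qed.

Lemma ray_step_dist (R : realType) (Z : normedModType R) (L : set Z) (b : R)
    (x y : Z) :
  L `<=` unit_sphere (Z := Z) -> ray_step L b x y -> `|y - x| < b.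
Proof.
move=> Ls [t [l [t0 tb /Ls l1 ->]]].
by rewrite addrC addKr normrZ (l1 : `|l| = 1) mulr1 ger0_norm.
Qed.

Lemma min_time_ltP (R : realType) (Z : normedModType R) (L : set Z) (x : Z)
    (A : set Z) (b : R) :
  (min_time L x A < b%:E)%E <-> exists2 y, ray_step L b x y & A y.
Proof.
split.
  move=> /ereal_inf_lt[_ [t [t0 [_ [[l Ll <-] Aw]]] <-]]; rewrite lte_fin => tb.
  by exists (x + t *: l) => //; exists t, l.
move=> [y [t [l [t0 tb Ll yE]]] Ay].
apply: (@le_lt_trans _ _ t%:E); last by rewrite lte_fin.
apply: ereal_inf_lbound; exists t => //; split => //.
by exists y; split => //; exists l.
Qed.

Lemma min_time_ge0 (R : realType) (Z : normedModType R) (L : set Z) (x : Z)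
    (A : set Z) : (0 <= min_time L x A)%E.
Proof. by apply: le_ereal_inf_tmp => _ [t [t0 _] <-]; rewrite lee_fin. Qed.

Lemma dist_le (R : realType) (Z : normedModType R) (x y : Z) (A : set Z) :
  A y -> (dist x A <= `|x - y|%:E)%E.
Proof. by move=> Ay; apply: ereal_inf_lbound; exists y. Qed.

(** Regularity compares infima, which need not be attained. Replacing [tau] by the larger [k] makes
    the bound strict and leaves room to pick an actual point [x']. *)
Lemma milyutin_step (R : realType) (X Y : normedModType R) (F : X -> set Y)
    (U : set X) (V : set Y) (L : set X) (M : set Y) (tau k b : R)
    (x : X) (y y' : Y) :
  milyutin_regular F U V L M tau -> 0 < tau -> tau < k -> 0 < b ->
  U x -> V y -> (forall x', `|x - x'| < k * b -> U x') ->
  ray_step M b y y' -> F x y' ->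
  exists2 x', ray_step L (k * b) x x' & F x' y.
Proof.
move=> reg tau0 tauk b0 Ux Vy ball_U stepy Fxy'.
have time_lt : (min_time M y (F x) < b%:E)%E by apply/min_time_ltP; exists y'.
have tau_time : (tau%:E * min_time M y (F x) < (k * b)%:E)%E.
  apply: (@lt_trans _ _ (tau * b)%:E); last by rewrite lte_fin ltr_pM2r.
  by rewrite EFinM lte_pmul2l// lte_fin.
have le_dist : ((k * b)%:E <= dist x (~` U))%E.
  apply: le_ereal_inf_tmp => _ [a nUa <-]; rewrite lee_fin leNgt.
  by apply/negP => /ball_U.
apply/min_time_ltP; apply: (le_lt_trans _ tau_time).
by apply: reg => //; exact: lt_le_trans le_dist.
Qed.

(** Bundles hypotheses that are stable under negating both [L] and [M]. The stability serves the
    alternating orbit as well as the reduction of (delta) to (gamma). *)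
Record biregular (R : realType) (X Y : normedModType R) (F1 : X -> set Y)
    (F2 : Y -> set X) (U : set X) (V : set Y) (tau1 tau2 : R)
    (L : set X) (M : set Y) : Prop := Biregular {
  biregular_L : L `<=` unit_sphere (Z := X);
  biregular_M : M `<=` unit_sphere (Z := Y);
  biregular_1 : milyutin_regular F1 U V L M tau1;
  biregular_1N : milyutin_regular F1 U V (opp_set L) (opp_set M) tau1;
  biregular_2 : milyutin_regular F2 V U M L tau2;
  biregular_2N : milyutin_regular F2 V U (opp_set M) (opp_set L) tau2 }.

Lemma biregular_opp (R : realType) (X Y : normedModType R) (F1 : X -> set Y)
    (F2 : Y -> set X) (U : set X) (V : set Y) (tau1 tau2 : R)
    (L : set X) (M : set Y) :
  biregular F1 F2 U V tau1 tau2 L M ->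
  biregular F1 F2 U V tau1 tau2 (opp_set L) (opp_set M).
Proof.
move=> [? ? ? ? ? ?].
by split; rewrite ?opp_setK//; exact: opp_set_sphere.
Qed.

(** * Sequences with geometric step bounds *)

(** Telescoping: the bound on step [n] equals [c * (k ^+ n - k ^+ n.+1)]. *)
Lemma geometric_dist (R : realType) (Z : normedModType R) (z : nat -> Z)
    (c k : R) (n m : nat) :
  (forall n, `|z n.+1 - z n| <= c * (1 - k) * k ^+ n) ->
  `|z (n + m)%N - z n| <= c * (k ^+ n - k ^+ (n + m)).
Proof.
move=> zk; elim: m => [|m IH]; first by rewrite addn0 !subrr normr0 mulr0.
rewrite addnS -(subrKA (z (n + m)%N)) (le_trans (ler_normD _ _))//.
apply: le_trans (lerD (zk _) IH) _.
rewrite exprS le_eqVlt; apply/orP; left; apply/eqP; ring.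
Qed.

Lemma geometric_cvg (R : realType) (Z : normedModType R) (z : nat -> Z)
    (c k : R) :
  is_complete Z -> 0 <= c -> 0 <= k < 1 ->
  (forall n, `|z n.+1 - z n| <= c * (1 - k) * k ^+ n) -> cvgn z.
Proof.
move=> complZ c0 /andP[k0 k1] zk; apply: complZ.
apply: cauchy_exP => e e0.
have : (c * k ^+ n) @[n --> \oo] --> c * 0.
  by apply: cvgM; [exact: cvg_cst | apply: cvg_expr; rewrite ger0_norm].
rewrite mulr0 => /cvgrPdist_lt/(_ _ e0)[N _ /(_ N (leqnn N))].
rewrite /= sub0r normrN ger0_norm ?mulr_ge0 ?exprn_ge0// => ckN.
(* The centre may depend on [e]: all terms from [N] on are within [c * k ^+ N < e] of [z N]. *)
exists (z N); exists N => // n /= Nn.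
rewrite -ball_normE /= distrC -(subnKC Nn).
apply: le_lt_trans (geometric_dist _ _ zk) _; apply: le_lt_trans ckN.
by rewrite ler_wpM2l// lerBlDr lerDl exprn_ge0.
Qed.

(** * Construction of the orbit *)

(* The n-th step goes along L, M for n even and along -L, -M for n odd:
   backwards, from z n.+1 to z n, its directions are those of step n.+1, so
   its length bounds the minimal times in the regularity hypotheses for
   step n.+1. *)
Lemma exists_orbit (R : realType) (X Y : normedModType R) (F1 : X -> set Y)
    (F2 : Y -> set X) (U : set X) (V : set Y) (tau1 tau2 c k : R)
    (L : set X) (M : set Y) (z0 : X * Y) :
  biregular F1 F2 U V tau1 tau2 L M ->
  0 < tau1 -> 0 < tau2 -> tau1 < k -> tau2 < k -> k < 1 -> 0 < c ->
  (forall z, `|z0 - z| <= c -> (U `*` V) z) ->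
  (min_time L z0.1 (inv_map F1 z0.2) < (c * (1 - k))%:E)%E ->
  (min_time M z0.2 (inv_map F2 z0.1) < (c * (1 - k))%:E)%E ->
  exists z : nat -> X * Y, [/\ z 0%N = z0,
    forall n, prod_map F1 F2 (z n.+1) (z n) &
    forall n, `|z n.+1 - z n| <= c * (1 - k) * k ^+ n].
Proof.
move=> reg tau10 tau20 tau1k tau2k k1 c0 ball_UV timeL timeM.
have k0 : 0 < k by exact: lt_trans tau1k.
pose Ln n := iter n (@opp_set R X) L; pose Mn n := iter n (@opp_set R Y) M.
have regn n : biregular F1 F2 U V tau1 tau2 (Ln n) (Mn n).
  by elim: n => // n /biregular_opp.
pose b n := c * (1 - k) * k ^+ n.
have b0 n : 0 < b n by rewrite !mulr_gt0 ?subr_gt0 ?exprn_gt0.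
have bS n : k * b n = b n.+1 by rewrite /b exprS; ring.
pose link n (z w : X * Y) := [/\ ray_step (Ln n) (b n) z.1 w.1,
  ray_step (Mn n) (b n) z.2 w.2 & prod_map F1 F2 w z].
(* [c * (1 - k ^+ n)] is the sum of the bounds [b i] over [i < n]. *)
pose inv n z w := `|z - z0| <= c * (1 - k ^+ n) /\ link n z w.
have link_dist n z w : link n z w -> `|w - z| < b n.
  move=> [lz1 lz2 _]; rewrite prod_max_norm gt_max.
  by rewrite !(ray_step_dist _ lz1, ray_step_dist _ lz2)//; case: (regn n).
have step n z w : inv n z w -> exists w', inv n.+1 w w'.
  move=> [z_near lzw].
  have w_near : `|w - z0| <= c * (1 - k ^+ n.+1).
    rewrite -(subrKA z) (le_trans (ler_normD _ _))//.
    apply: le_trans (lerD (ltW (link_dist _ _ _ lzw)) z_near) _.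
    rewrite /b exprS le_eqVlt; apply/orP; left; apply/eqP; ring.
  (* Of the radius [c], the amount [c * k ^+ n.+1] is left at [w], and the next step uses only the
     fraction [1 - k] of it. *)
  have ball_w w' : `|w - w'| < b n.+1 -> (U `*` V) w'.
    move=> ww'; apply: ball_UV; rewrite distrC -(subrKA w).
    rewrite (le_trans (ler_normD _ _))// distrC.
    apply: le_trans (lerD (ltW ww') w_near) _.
    have -> : b n.+1 + c * (1 - k ^+ n.+1) = c - c * k * k ^+ n.+1.
      by rewrite /b; ring.
    by rewrite lerBlDr lerDl !mulr_ge0 ?exprn_ge0// ltW.
  have [Uw Vw] : (U `*` V) w by apply: ball_w; rewrite subrr normr0.
  (* The components cross over: [z.2] lies in [F1 w.1], so the backward step in [Y] feeds the
     regularity of [F1] and yields the next step in [X]; symmetrically for [F2]. *)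
  case: lzw => /ray_step_opp sz1 /ray_step_opp sz2 [F2z F1z].
  have [_ _ reg1 _ reg2 _] := regn n.+1.
  have [x' sx' Fx'] : exists2 x', ray_step (Ln n.+1) (k * b n) w.1 x' &
      F1 x' w.2.
    apply: (milyutin_step reg1 tau10 tau1k (b0 n) Uw Vw _ sz2 F1z).
    move=> x'; rewrite bS => wx'; have [] // := ball_w (x', w.2).
    by rewrite prod_max_norm /= subrr normr0 gt_max wx' b0.
  have [y' sy' Fy'] : exists2 y', ray_step (Mn n.+1) (k * b n) w.2 y' &
      F2 y' w.1.
    apply: (milyutin_step reg2 tau20 tau2k (b0 n) Vw Uw _ sz1 F2z).
    move=> y'; rewrite bS => wy'; have [] // := ball_w (w.1, y').
    by rewrite prod_max_norm /= subrr normr0 gt_max wy' b0.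
  by exists (x', y'); split => //; rewrite /link -bS.
have [w0 inv0] : exists w, inv 0%N z0 w.
  move: timeL timeM => /min_time_ltP[x sx Fx] /min_time_ltP[y sy Fy].
  exists (x, y); split; first by rewrite subrr normr0 expr0 subrr mulr0.
  by rewrite /link /b expr0 mulr1.
(* Dependent choice: a state holds the index and two consecutive points, since each step is built
   from the previous one. *)
pose S := {p : nat * ((X * Y) * (X * Y)) | inv p.1 p.2.1 p.2.2}.
pose next (s t : S) := (sval t).1 = (sval s).1.+1 /\
  (sval t).2.1 = (sval s).2.2.
have next_ex (s : S) : exists t, next s t.
  case: s => -[n [z w]] /= zw; have [w' ww'] := step _ _ _ zw.
  by exists (exist _ (n.+1, (w, w')) ww').
have [f fP] := choice next_ex.
pose s n := iter n f (exist _ (0%N, (z0, w0)) inv0 : S).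
have s1 n : (sval (s n)).1 = n.
  by elim: n => //= n IH; rewrite (fP _).1 IH.
have links n : link n (sval (s n)).2.1 (sval (s n.+1)).2.1.
  by rewrite [s n.+1]/= (fP _).2; have := svalP (s n); rewrite s1 => -[].
exists (fun n => (sval (s n)).2.1); split => // n.
- by have [] := links n.
- by apply/ltW/link_dist/links.
Qed.

(** * Approximate and exact fixed points from the orbit *)

Lemma orbit_near (R : realType) (Z : normedModType R) (z : nat -> Z)
    (c k : R) (n : nat) :
  0 <= c -> 0 <= k ->
  (forall n, `|z n.+1 - z n| <= c * (1 - k) * k ^+ n) -> `|z 0%N - z n| <= c.
Proof.
move=> c0 k0 zk; rewrite distrC (le_trans (geometric_dist 0 n zk))//.
by rewrite ler_piMr// expr0 ?gerBl ?exprn_ge0.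
Qed.

Lemma orbit_approx_Fix (R : realType) (Z : normedModType R) (F : Z -> set Z)
    (z : nat -> Z) (c k eps : R) :
  0 < eps -> 0 <= k < 1 -> (forall n, F (z n.+1) (z n)) ->
  (forall n, `|z n.+1 - z n| <= c * (1 - k) * k ^+ n) ->
  exists n, approx_Fix F eps (z n).
Proof.
move=> eps0 /andP[k0 k1] Fz zk.
have : (c * (1 - k) * k ^+ n) @[n --> \oo] --> c * (1 - k) * 0.
  by apply: cvgM; [exact: cvg_cst | apply: cvg_expr; rewrite ger0_norm].
rewrite mulr0 => /cvgrPdist_lt/(_ _ eps0)[N _ /(_ N (leqnn N))].
(* The index is [N.+1] because [z N] lies in [F (z N.+1)]: the distance to the image is at most the
   length of step [N]. *)
rewrite /= sub0r normrN => small; exists N.+1.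
apply: le_trans (dist_le _ (Fz N)) _.
by rewrite lee_fin (le_trans (zk N))// (le_trans (ler_norm _))// ltW.
Qed.

Lemma orbit_Fix (R : realType) (X Y : normedModType R) (F1 : X -> set Y)
    (F2 : Y -> set X) (z : nat -> X * Y) (c k : R) :
  is_complete X -> is_complete Y ->
  closed (graph F1) -> closed (graph F2) -> 0 <= c -> 0 <= k < 1 ->
  (forall n, prod_map F1 F2 (z n.+1) (z n)) ->
  (forall n, `|z n.+1 - z n| <= c * (1 - k) * k ^+ n) ->
  exists2 w, Fix (prod_map F1 F2) w & `|z 0%N - w| <= c.
Proof.
move=> complX complY clF1 clF2 c0 k01 Fz zk.
have zk1 n : `|(z n.+1).1 - (z n).1| <= c * (1 - k) * k ^+ n.
  by apply: le_trans (zk n); rewrite prod_max_norm le_max lexx.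
have zk2 n : `|(z n.+1).2 - (z n).2| <= c * (1 - k) * k ^+ n.
  by apply: le_trans (zk n); rewrite prod_max_norm le_max lexx orbT.
have /cvg_ex[/= x zx] := geometric_cvg complX c0 k01 zk1.
have /cvg_ex[/= y zy] := geometric_cvg complY c0 k01 zk2.
(* The graphs contain pairs that mix the indices [n.+1] and [n]; the shifted sequences have the same
   limits. *)
have zSx : (z n.+1).1 @[n --> \oo] --> x by have := zx; rewrite -cvg_shiftS.
have zSy : (z n.+1).2 @[n --> \oo] --> y by have := zy; rewrite -cvg_shiftS.
exists (x, y).
  split.
  - apply: (closed_cvg _ clF2 _ (y, x) (cvg_pair zSy zx)).
    by apply: nearW => n; have [] := Fz n.
  - apply: (closed_cvg _ clF1 _ (x, y) (cvg_pair zSx zy)).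
    by apply: nearW => n; have [] := Fz n.
have dist_cvg : `|z 0%N - ((z n).1, (z n).2)| @[n --> \oo]
    --> `|z 0%N - (x, y)|.
  by apply: cvg_norm; apply: cvgB; [exact: cvg_cst | exact: cvg_pair].
apply: (closed_cvg _ (@closed_le R c) _ _ dist_cvg).
apply: nearW => n; case/andP : k01 => k0 _.
by rewrite /= -surjective_pairing; exact: orbit_near zk.
Qed.

(** * Distance estimates *)

(** Lets the orbit radius [c] decrease to [p]. The cap [r], possibly infinite, keeps the closed
    [c]-balls inside [U x V] in the application. *)
Lemma dist_le_of_near (R : realType) (Z : normedModType R) (z0 : Z)
    (S : set Z) (p : R) (r : \bar R) :
  (p%:E < r)%E ->
  (forall c, p < c -> (c%:E < r)%E -> exists2 z, S z & `|z0 - z| <= c) ->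
  S !=set0 /\ (dist z0 S <= p%:E)%E.
Proof.
move=> pr near_S.
have between (s : \bar R) : (p%:E < s)%E -> exists2 c, p < c & (c%:E < s)%E.
  case: s => [s|_|//]; last by exists (p + 1); rewrite ?ltrDl ?ltry.
  by rewrite lte_fin => ps; exists ((p + s) / 2); rewrite ?lte_fin ?midf_lt.
split.
  have [c pc cr] := between _ pr.
  by have [z Sz _] := near_S c pc cr; exists z.
rewrite leNgt; apply/negP => p_dist.
(* If the distance exceeded [p], some [c] below both it and [r] would give a point of [S] closer
   than the infimum. *)
have [|c pc] := between (mine (dist z0 S) r); first by rewrite lt_min p_dist pr.
rewrite lt_min => /andP[c_dist cr].
have [z Sz zc] := near_S c pc cr.
have := lt_le_trans c_dist (dist_le z0 Sz).
by rewrite lte_fin ltNge zc.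
Qed.

(* Given c > T / (1 - tau), the ratio k > tau of the orbit is chosen such that
   T < c (1 - k); the orbit then stays within distance c of its start. *)
Lemma near_fixed_point (R : realType) (X Y : normedModType R) (F1 : X -> set Y)
    (F2 : Y -> set X) (U : set X) (V : set Y) (tau1 tau2 c T : R)
    (L : set X) (M : set Y) (z0 : X * Y) :
  biregular F1 F2 U V tau1 tau2 L M ->
  0 < tau1 -> 0 < tau2 -> Num.max tau1 tau2 < 1 -> 0 <= T ->
  T / (1 - Num.max tau1 tau2) < c ->
  (forall z, `|z0 - z| <= c -> (U `*` V) z) ->
  (min_time L z0.1 (inv_map F1 z0.2) <= T%:E)%E ->
  (min_time M z0.2 (inv_map F2 z0.1) <= T%:E)%E ->
  (forall eps, 0 < eps -> exists2 z,
    (approx_Fix (prod_map F1 F2) eps `&` (U `*` V)) z & `|z0 - z| <= c) /\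
  (is_complete X -> is_complete Y -> closed (graph F1) -> closed (graph F2) ->
    exists2 z,
      (Fix (prod_map F1 F2) `&` (U `*` V)) z & `|z0 - z| <= c).
Proof.
set tau := Num.max tau1 tau2 => reg tau10 tau20 tau_lt1 T0 Tc ball_UV timeL timeM.
have tau0 : 0 < tau by rewrite lt_max tau10.
have c0 : 0 < c by apply: le_lt_trans Tc; rewrite divr_ge0// subr_ge0 ltW.
have tau_lt : tau < 1 - T / c.
  by rewrite ltrBrDl -ltrBrDr ltr_pdivrMr// mulrC -ltr_pdivrMr// subr_gt0.
(* [T < c * (1 - k)] amounts to [k < 1 - T / c], so the midpoint of [tau] and [1 - T / c] meets both
   requirements on [k]. *)
pose k := (tau + (1 - T / c)) / 2.
have tau_k : tau < k by rewrite midf_lt.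
have k_lt : k < 1 - T / c by rewrite midf_lt.
have k1 : k < 1 by apply: lt_le_trans k_lt _; rewrite gerBl divr_ge0// ltW.
have k01 : 0 <= k < 1 by rewrite k1 (ltW (lt_trans tau0 tau_k)).
have TE : (T%:E < (c * (1 - k))%:E)%E.
  by rewrite lte_fin mulrC -ltr_pdivrMr// ltrBrDl -ltrBrDr.
have tau1k : tau1 < k by apply: le_lt_trans tau_k; rewrite le_max lexx.
have tau2k : tau2 < k by apply: le_lt_trans tau_k; rewrite le_max lexx orbT.
have [z [zE Fz zk]] := exists_orbit reg tau10 tau20 tau1k tau2k k1 c0 ball_UV
  (le_lt_trans timeL TE) (le_lt_trans timeM TE).
split=> [eps eps0|complX complY clF1 clF2].
  have [n zn] := orbit_approx_Fix eps0 k01 Fz zk.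
  have zn_near : `|z0 - z n| <= c.
    by rewrite -zE; case/andP: k01 => k0 _; apply: orbit_near zk => //; exact: ltW.
  by exists (z n) => //; split => //; exact: ball_UV.
have [w Fw] := orbit_Fix complX complY clF1 clF2 (ltW c0) k01 Fz zk.
by rewrite zE => w_near; exists w => //; split => //; exact: ball_UV.
Qed.

Lemma fixed_point_estimate (R : realType) (X Y : normedModType R)
    (F1 : X -> set Y) (F2 : Y -> set X) (U : set X) (V : set Y) (tau1 tau2 : R)
    (L : set X) (M : set Y) (u : X) (v : Y) :
  let calF := prod_map F1 F2 in
  let tau := Num.max tau1 tau2 in
  let bound := (min_time_prod L M (u, v) (inv_map calF (u, v))
    / (1 - tau)%:E)%E in
  biregular F1 F2 U V tau1 tau2 L M -> 0 < tau1 -> 0 < tau2 -> tau < 1 ->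
  (maxe (min_time L u (inv_map F1 v)) (min_time M v (inv_map F2 u))
    < (1 - tau)%:E * mine (dist u (~` U)) (dist v (~` V)))%E ->
  (forall eps, 0 < eps ->
    approx_Fix calF eps `&` (U `*` V) !=set0 /\
    (dist (u, v) (approx_Fix calF eps `&` (U `*` V)) <= bound)%E) /\
  (is_complete X -> is_complete Y -> closed (graph F1) -> closed (graph F2) ->
    Fix calF `&` (U `*` V) !=set0 /\
    (dist (u, v) (Fix calF `&` (U `*` V)) <= bound)%E).
Proof.
move=> calF tau bound reg tau10 tau20 tau_lt1; rewrite {}/bound /calF.
rewrite inv_prod_map min_time_prodE.
set mT := maxe _ _; set r := mine _ _ => mT_lt.
have tau_sub : 0 < 1 - tau by rewrite subr_gt0.
have timeL : (min_time L u (inv_map F1 v) <= mT)%E by rewrite le_max lexx.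
have timeM : (min_time M v (inv_map F2 u) <= mT)%E by rewrite le_max lexx orbT.
have mT0 : (0 <= mT)%E := le_trans (min_time_ge0 _ _ _) timeL.
(* The strict upper bound excludes [+oo], so the minimal times can be bounded by a real [T]. *)
have mT_fin : mT \is a fin_num by rewrite ge0_fin_numE// (lt_le_trans mT_lt)// leey.
move: mT_lt mT0 timeL timeM; rewrite -(fineK mT_fin); move: (fine mT) => T.
rewrite lee_fin muleC -lte_pdivrMr// => T_lt T0 timeL timeM.
have {}T_lt : ((T / (1 - tau))%:E < r)%E by rewrite EFinM.
(* The extended inverse of [1 - tau] is the real one, as [1 - tau] is nonzero. *)
rewrite inver gt_eqF// -EFinM.
(* A point outside [U] or [V] would be at distance at least [r > c] from [u] or [v] in that
   component. *)
have ball_UV c : (c%:E < r)%E -> forall z, `|(u, v) - z| <= c -> (U `*` V) z.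
  rewrite lt_min => /andP[c_lt1 c_lt2] [x y].
  rewrite prod_max_norm ge_max /= => /andP[ux vy]; split => /=;
    apply: contrapT => nA.
  - by have := lt_le_trans c_lt1 (dist_le u nA); rewrite lte_fin ltNge ux.
  - by have := lt_le_trans c_lt2 (dist_le v nA); rewrite lte_fin ltNge vy.
have near c (Tc : T / (1 - tau) < c) (cr : (c%:E < r)%E) :=
  near_fixed_point reg tau10 tau20 tau_lt1 T0 Tc (ball_UV c cr) timeL timeM.
split=> [eps eps0|complX complY clF1 clF2];
  apply: (dist_le_of_near T_lt) => c Tc cr.
- by have [+ _] := near c Tc cr; exact.
- by have [_ +] := near c Tc cr; exact.
Qed.

Unset Implicit Arguments.
Local Open Scope ereal_scope.

Theorem theorem4p4 (R : realType) (X Y : normedModType R)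
    (F1 : X -> set Y) (F2 : Y -> set X)
    (L : set X) (M : set Y) (U : set X) (V : set Y) (tau1 tau2 : R)
    (ubar : X) (vbar : Y) :
  let calF := prod_map F1 F2 in
  let tau := Num.max tau1 tau2 in
  let radius := mine (dist ubar (~` U)) (dist vbar (~` V)) in
  let gamma :=
    maxe (min_time L ubar (inv_map F1 vbar)) (min_time M vbar (inv_map F2 ubar))
      < (1 - tau)%:E * radius in
  let delta :=
    maxe (min_time (opp_set L) ubar (inv_map F1 vbar))
         (min_time (opp_set M) vbar (inv_map F2 ubar))
      < (1 - tau)%:E * radius in
  L !=set0 -> L `<=` unit_sphere (Z := X) ->
  M !=set0 -> M `<=` unit_sphere (Z := Y) ->
  open U -> open V ->
  (0 < tau1)%R -> (0 < tau2)%R ->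
  milyutin_regular F1 U V L M tau1 ->
  milyutin_regular F1 U V (opp_set L) (opp_set M) tau1 ->
  milyutin_regular F2 V U M L tau2 ->
  milyutin_regular F2 V U (opp_set M) (opp_set L) tau2 ->
  (tau < 1)%R ->
  U ubar -> V vbar ->
  gamma \/ delta ->
  (forall eps : R, (0 < eps)%R ->
     [/\ approx_Fix calF eps `&` (U `*` V) !=set0,
         gamma ->
           dist (ubar, vbar) (approx_Fix calF eps `&` (U `*` V))
           <= min_time_prod L M (ubar, vbar) (inv_map calF (ubar, vbar))
              / (1 - tau)%:E
       & delta ->
           dist (ubar, vbar) (approx_Fix calF eps `&` (U `*` V))
           <= min_time_prod (opp_set L) (opp_set M) (ubar, vbar)
                (inv_map calF (ubar, vbar))
              / (1 - tau)%:E])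
  /\
  (is_complete X -> is_complete Y -> closed (graph F1) -> closed (graph F2) ->
     [/\ Fix calF `&` (U `*` V) !=set0,
         gamma ->
           dist (ubar, vbar) (Fix calF `&` (U `*` V))
           <= min_time_prod L M (ubar, vbar) (inv_map calF (ubar, vbar))
              / (1 - tau)%:E
       & delta ->
           dist (ubar, vbar) (Fix calF `&` (U `*` V))
           <= min_time_prod (opp_set L) (opp_set M) (ubar, vbar)
                (inv_map calF (ubar, vbar))
              / (1 - tau)%:E]).
Proof.
move=> calF tau radius gamma delta _ Lsphere _ Msphere _ _ tau10 tau20.
move=> reg1 reg1N reg2 reg2N tau_lt1 _ _ gamma_delta.
have reg : biregular F1 F2 U V tau1 tau2 L M by [].
have est_gamma := fixed_point_estimate reg tau10 tau20 tau_lt1.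
have est_delta := fixed_point_estimate (biregular_opp reg) tau10 tau20 tau_lt1.
split=> [eps eps0|complX complY clF1 clF2].
- split=> [|/est_gamma|/est_delta].
  + by case: gamma_delta => [/est_gamma|/est_delta] [/(_ _ eps0)[]].
  + by move=> [/(_ _ eps0)[]].
  + by move=> [/(_ _ eps0)[]].
- split=> [|/est_gamma|/est_delta].
  + by case: gamma_delta => [/est_gamma|/est_delta]
      [_ /(_ complX complY clF1 clF2)[]].
  + by move=> [_ /(_ complX complY clF1 clF2)[]].
  + by move=> [_ /(_ complX complY clF1 clF2)[]].
Qed.
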